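(* Let $X=(X,\omega_X)$ be a 1-dimensional tropical fan in $\mathbb R^n$. Then $X$ is smooth at $\mathbf 0$ if and only if the weighted evaluation map $\phi_X:\mathbb B[x^{\pm}]_{\mathrm{fcn}}\to\mathbb Z^{X(1)}_{\mathrm{pos}}\cup\{-\infty\}$ is surjective.
   Context: $\mathbb B=\{-\infty,0\}$ is the Boolean semifield with $\oplus=\max$, $\odot=+$. $\mathbb B[x^{\pm}]=\mathbb B[x_1^{\pm},\dots,x_n^{\pm}]$ is the semiring of Boolean Laurent polynomials $P=\bigoplus_{u}a_u\odot x^u$ ($u\in\mathbb Z^n$, $a_u\in\mathbb B$, $a_u=-\infty$ for all but finitely many $u$), with value $P(q)=\max_u\{a_u+u\cdot q\}$ at $q\in\mathbb R^n$. $\mathbb B[x^{\pm}]_{\mathrm{fcn}}$ is its quotient by the congruence identifying polynomials with the same values on all of $\mathbb R^n$; elements are regarded as functions on $\mathbb R^n$. A rational ray in $\mathbb R^n$ is a set $\{td: t\ge0\}$ with $d\in\mathbb Z^n\smallsetminus\{0\}$; its primitive direction vector is the unique primitive integer vector spanning it. A 1-dimensional tropical fan $X=(X,\omega_X)$ in $\mathbb R^n$ is a set $X=\{\{0\},\rho_1,\dots,\rho_r\}$ ($r\ge1$, $\rho_i$ distinct rational rays), with $X(1)=\{\rho_1,\dots,\rho_r\}$ and weights $\omega_X:X(1)\to\mathbb Z_{>0}$, such that $\sum_{\rho\in X(1)}w_\rho d_\rho=0$, where $w_\rho=\omega_X(\rho)$ and $d_\rho$ is the primitive direction vector of $\rho$.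 $|X|$ is the union of its rays. $\mathbb Z^{X(1)}_{\mathrm{pos}}=\{F:X(1)\to\mathbb Z : \sum_{\rho}F(\rho)\ge0\}$; $\mathbb Z^{X(1)}_{\mathrm{pos}}\cup\{-\infty\}$ is a semiring under pointwise max and pointwise $+$ ($-\infty$ = constant map $-\infty$). The weighted evaluation map is $\phi_X(f)(\rho)=w_\rho f(d_\rho)$. For integers $2\le r\le n+1$, let $e_1,\dots,e_n$ be the standard basis of $\mathbb R^n$, $e_0=-(e_1+\cdots+e_{r-1})$; $L_{n,r}$ is the 1-dimensional tropical fan whose rays are those spanned by $e_0,e_1,\dots,e_{r-1}$, all with weight $1$. A 1-dimensional tropical fan $X$ in $\mathbb R^n$ with $r$ rays is smooth at $\mathbf 0$ if (1) ($r\le n+1$, so that $L_{n,r}$ is defined, and) there exists $T\in GL(n,\mathbb Z)$ such that the linear map defined by $T$ induces a bijection from $|L_{n,r}|$ to $|X|$, and (2) $\omega_X(\rho)=1$ for all $\rho\in X(1)$. *)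

(* Defs.v *)
From HB Require Import structures.
From mathcomp Require Import all_boot all_order all_algebra.
From mathcomp Require Import generic_quotient finmap.
From mathcomp Require Import all_classical all_reals.

Set Implicit Arguments.
Unset Strict Implicit.
Unset Printing Implicit Defensive.

Import Order.TTheory GRing.Theory Num.Theory.

Local Open Scope classical_set_scope.
Local Open Scope ring_scope.

(* Vectors of Z^n and R^n are column vectors.  [intv] is the inclusion of Z^n
   in R^n. *)
Definition intv (R : realType) (n : nat) (d : 'cV[int]_n) : 'cV[R]_n :=
  map_mx intr d.

Definition dotp (R : realType) (n : nat) (u : 'cV[int]_n) (q : 'cV[R]_n) : R :=
  \sum_(i < n) (u i 0)%:~R * q i 0.

(* An element of the Boolean semifield {-oo, 0} is encoded by a boolean: true
   stands for 0 and false for -oo, so that max is || and + is &&. *)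
Definition bval (R : realType) (a : bool) : \bar R :=
  if a then 0%E else -oo%E.

(* The coefficient function u |-> a_u of a Boolean Laurent polynomial. *)
Definition boolLaurent (n : nat) : Type :=
  {fsfun 'cV[int]_n -> bool with false}.

HB.instance Definition _ (n : nat) := Choice.on (boolLaurent n).

(* P(q) is the maximum of a_u + u.q; the exponents outside the finite support
   of P contribute -oo. *)
Definition bl_eval (R : realType) (n : nat) (P : boolLaurent n) (q : 'cV[R]_n) :
    \bar R :=
  \big[maxe/-oo%E]_(u <- finsupp P) (bval R (P u) + (dotp u q)%:E)%E.

Section BoolLaurentFunctions.
Local Open Scope quotient_scope.
Variables (R : realType) (n : nat).

Definition fcn_eqv (P Q : boolLaurent n) : bool :=
  `[< forall q : 'cV[R]_n, bl_eval P q = bl_eval Q q >].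

Lemma fcn_eqv_refl : reflexive fcn_eqv.
Proof. by move=> P; apply/asboolP. Qed.

Lemma fcn_eqv_sym : symmetric fcn_eqv.
Proof. by move=> P Q; apply/asboolP/asboolP => h q; rewrite h. Qed.

Lemma fcn_eqv_trans : transitive fcn_eqv.
Proof.
by move=> Q P S /asboolP h1 /asboolP h2; apply/asboolP => q; rewrite h1 h2.
Qed.

Canonical fcn_equiv := EquivRel fcn_eqv fcn_eqv_refl fcn_eqv_sym fcn_eqv_trans.

Definition boolLaurent_fcn : Type := {eq_quot fcn_equiv}%qT.

HB.instance Definition _ := Choice.on boolLaurent_fcn.
HB.instance Definition _ := EqQuotient.on boolLaurent_fcn.

Definition fcn_eval (f : boolLaurent_fcn) (q : 'cV[R]_n) : \bar R :=
  bl_eval (repr f) q.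

Lemma fcn_eval_pi (P : boolLaurent n) (q : 'cV[R]_n) :
  fcn_eval (\pi_boolLaurent_fcn P) q = bl_eval P q.
Proof.
have /eqmodP/asboolP : \pi_boolLaurent_fcn (repr (\pi_boolLaurent_fcn P)) =
  \pi_boolLaurent_fcn P by rewrite reprK.
exact.
Qed.

End BoolLaurentFunctions.

Definition ray (R : realType) (n : nat) (d : 'cV[int]_n) : set 'cV[R]_n :=
  [set t *: intv R d | t in [set t : R | 0 <= t]].
Arguments ray R {n} d.

Definition rational_ray (R : realType) (n : nat) (rho : set 'cV[R]_n) : Prop :=
  exists2 d : 'cV[int]_n, d != 0 & rho = ray R d.

Definition vgcd (n : nat) (d : 'cV[int]_n) : nat :=
  \big[gcdn/0%N]_(i < n) `|(d i 0)%R|%N.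

Definition primitive (n : nat) (d : 'cV[int]_n) : bool := vgcd d == 1%N.

(* Meaningful for rational rays only; see [prim_dirP] and [prim_dir_ray]. *)
Definition prim_dir (R : realType) (n : nat) (rho : set 'cV[R]_n) : 'cV[int]_n :=
  xget 0 [set d | primitive d /\ rho = ray R d].

Section PrimitiveDirection.
Variables (R : realType) (n : nat).
Implicit Types (d : 'cV[int]_n) (rho : set 'cV[R]_n).

Lemma intvZ (m : int) d : intv R (m *: d) = m%:~R *: intv R d.
Proof. by apply/matrixP => i j; rewrite !mxE intrM. Qed.

Lemma vgcdZ (m : nat) d : vgcd (m%:Z *: d) = (m * vgcd d)%N.
Proof.
rewrite /vgcd (big_morph (muln m) (muln_gcdr m) (muln0 m)).
by apply: eq_bigr => i _; rewrite mxE abszM.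
Qed.

Lemma primitive_neq0 d : primitive d -> d != 0.
Proof.
apply: contraTneq => ->; rewrite /primitive /vgcd big1 // => i _.
by rewrite mxE.
Qed.

Lemma neq0_coord d : d != 0 -> exists i, d i 0 != 0.
Proof.
move=> d0; apply/existsP; apply: contraR d0 => /existsPn h.
by apply/eqP/matrixP => i j; rewrite ord1 mxE; move/negPn/eqP: (h i).
Qed.

Lemma ray_inj d d' : primitive d -> primitive d' -> ray R d = ray R d' -> d = d'.
Proof.
move=> pd pd' e.
have : ray R d (intv R d) by exists 1 => /=; rewrite ?ler01 ?scale1r.
rewrite e => -[t /= t0 td].
have tE k : (d k 0)%:~R = t * (d' k 0)%:~R.
  by move/matrixP: td => /(_ k 0); rewrite !mxE.
have [i di] := neq0_coord (primitive_neq0 pd').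
have tE' : (`|(d i 0)%R|%N)%:R = t * (`|(d' i 0)%R|%N)%:R :> R.
  by rewrite !natr_absz !intr_norm tE normrM (ger0_norm t0).
have E : (`|(d' i 0)%R|%N)%:Z *: d = (`|(d i 0)%R|%N)%:Z *: d'.
  apply/matrixP => k j; rewrite ord1 !mxE; apply: (@intr_inj R).
  by rewrite !intrM tE mulrCA -!pmulrn tE' mulrA [t * _ * _]mulrC mulrA.
have := vgcdZ `|(d' i 0)%R|%N d; rewrite E vgcdZ.
rewrite (eqP pd) (eqP pd') !muln1 => eq_abs.
apply/matrixP => k j; move/matrixP: E => /(_ k j); rewrite eq_abs !mxE.
by apply: mulfI; rewrite eqz_nat absz_eq0.
Qed.

Lemma ray_primitive d : d != 0 -> exists2 d', primitive d' & ray R d = ray R d'.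
Proof.
move=> d0; set g := vgcd d.
have gP i : (g %| `|(d i 0)%R|)%N by exact: (@biggcdn_inf _ i).
have [i di] := neq0_coord d0.
have g0 : (0 < g)%N.
  by rewrite lt0n; apply: contraTneq (gP i) => ->; rewrite dvd0n absz_eq0.
pose d' := \col_i ((d i 0)%R %/ g%:Z)%Z.
have dE : d = g%:Z *: d'.
  apply/matrixP => k j; rewrite ord1 !mxE mulrC divzK //.
  exact: gP.
exists d'.
  by rewrite /primitive -(eqn_pmul2l g0) -vgcdZ -dE muln1.
have g0R : 0 < g%:R :> R by rewrite ltr0n.
rewrite [X in ray R X]dE; apply/seteqP; split => _ [t /= t0 <-].
  exists (t * g%:R) => /=; first by rewrite mulr_ge0 // ltW.
  by rewrite intvZ scalerA.
exists (t / g%:R) => /=; first by rewrite divr_ge0 // ltW.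
by rewrite intvZ scalerA -pmulrn divfK // gt_eqF.
Qed.

Lemma prim_dirP rho : rational_ray rho ->
  primitive (prim_dir rho) /\ rho = ray R (prim_dir rho).
Proof.
move=> [d /ray_primitive [d' pd' dE] rhoE].
apply: (@xgetPex _ 0 [set d | primitive d /\ rho = ray R d]).
by exists d'; split; rewrite // rhoE.
Qed.

Lemma prim_dir_ray d : primitive d -> prim_dir (ray R d) = d.
Proof.
move=> pd.
have [pd' e] := prim_dirP (ex_intro2 _ _ d (primitive_neq0 pd) (erefl (ray R d))).
exact/esym/ray_inj.
Qed.

End PrimitiveDirection.

(* A 1-dimensional tropical fan {{0}, rho_1, ..., rho_r} is given by its set
   X(1) of rays; a finite set of sets coerces to the type of its elements. *)
Record tropical_fan (R : realType) (n : nat) := TropicalFan {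
  rays : {fset (set 'cV[R]_n)};
  weight : rays -> int;
  rays_neq0 : (0 < #|` rays|)%N;
  rays_rational : forall rho, rho \in rays -> rational_ray rho;
  weight_gt0 : forall rho, 0 < weight rho;
  balanced : \sum_(rho : rays) weight rho *: prim_dir (val rho) = 0
}.

Definition fan_support (R : realType) (n : nat) (X : tropical_fan R n) :
    set 'cV[R]_n :=
  \bigcup_(rho in [set` rays X]) rho.

(* The set Z^X(1)_pos U {-oo}, whose elements are seen as functions with values
   in Z U {-oo}, a subset of \bar R. *)
Definition Zpos_ninfty (R : realType) (n : nat) (X : tropical_fan R n) :
    set (rays X -> \bar R) :=
  [set G | G = (fun=> -oo%E) \/
     exists2 F : rays X -> int, 0 <= \sum_(rho : rays X) F rho
                              & G = (fun rho => (F rho)%:~R%:E)].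
Arguments Zpos_ninfty {R n} X.

Definition weighted_eval (R : realType) (n : nat) (X : tropical_fan R n)
    (f : boolLaurent_fcn R n) : rays X -> \bar R :=
  fun rho => ((weight rho)%:~R%:E * fcn_eval f (intv R (prim_dir (val rho))))%E.
Arguments weighted_eval {R n} X f rho.

Lemma bl_eval0 (R : realType) (n : nat) (P : boolLaurent n) (q : 'cV[R]_n) :
  finsupp P = fset0 -> bl_eval P q = -oo%E.
Proof. by move=> P0; rewrite /bl_eval P0 big_seq_fset0. Qed.

Lemma dotp_intv (R : realType) (n : nat) (u d : 'cV[int]_n) :
  dotp u (intv R d) = (\sum_(i < n) u i 0 * d i 0)%:~R.
Proof.
by rewrite rmorph_sum; apply: eq_bigr => i _; rewrite mxE rmorphM.
Qed.

Lemma bl_eval_intv (R : realType) (n : nat) (P : boolLaurent n) u :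
  u \in finsupp P -> exists m : 'cV[int]_n -> int, forall d,
    bl_eval P (intv R d) = (m d)%:~R%:E /\ \sum_(i < n) u i 0 * d i 0 <= m d.
Proof.
move=> uP.
suff h : forall d, exists m : int,
  bl_eval P (intv R d) = m%:~R%:E /\ \sum_(i < n) u i 0 * d i 0 <= m.
  by have [m mP] := choice h; exists m.
move=> d; rewrite /bl_eval.
have PE v : v \in finsupp P -> (bval R (P v) + (dotp v (intv R d))%:E)%E =
    ((\sum_(i < n) v i 0 * d i 0)%:~R)%:E.
  rewrite mem_finsupp; case: (P v) => // _.
  by rewrite add0e dotp_intv.
rewrite big_seq (eq_bigr _ PE) -big_seq.
have {uP PE} : u \in enum_fset (finsupp P) by [].
elim: (enum_fset _) => // v s IH.
have maxE (a b : int) : (Order.max a%:~R%:E b%:~R%:E : \bar R) =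
    ((Order.max a b)%:~R)%:E.
  by rewrite -EFin_max; congr EFin; rewrite /Order.max ltr_int; case: ifP.
rewrite big_cons inE => /orP[/eqP uv|/IH[m [-> um]]]; last first.
  exists (Order.max (\sum_(i < n) v i 0 * d i 0) m).
  by rewrite maxE le_max um orbT.
suff [->|[m ->]] : \big[maxe/-oo%E]_(w <- s)
    ((\sum_(i < n) w i 0 * d i 0)%:~R : R)%:E = -oo%E \/
    exists m : int, \big[maxe/-oo%E]_(w <- s)
    ((\sum_(i < n) w i 0 * d i 0)%:~R : R)%:E = (m%:~R)%:E.
- by exists (\sum_(i < n) v i 0 * d i 0); rewrite maxeNy uv.
- exists (Order.max (\sum_(i < n) v i 0 * d i 0) m).
  by rewrite maxE le_max uv lexx.
elim: {IH} s => [|w s [IH|[m IH]]]; first by left; rewrite big_nil.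
  by right; rewrite big_cons IH maxeNy; eexists.
right; rewrite big_cons IH; exists (Order.max (\sum_(i < n) w i 0 * d i 0) m).
exact: maxE.
Qed.

Lemma weighted_eval_fun (R : realType) (n : nat) (X : tropical_fan R n) :
  set_fun setT (Zpos_ninfty X) (weighted_eval X).
Proof.
move=> f _; rewrite /weighted_eval /fcn_eval.
have [P0|[u uP]] := fset_0Vmem (finsupp (repr f)).
  left; apply/funext => rho; rewrite bl_eval0 // gt0_muleNy //.
  by rewrite lte_fin ltr0z weight_gt0.
have [m mP] := bl_eval_intv R uP; right.
exists (fun rho => weight rho * m (prim_dir (val rho))); last first.
  by apply/funext => rho; rewrite (mP _).1 -EFinM intrM.
apply: (@le_trans _ _ (\sum_(rho : rays X) weight rho *
    \sum_(i < n) u i 0 * prim_dir (val rho) i 0)).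
  under eq_bigr do rewrite mulr_sumr.
  rewrite exchange_big big1 //= => i _.
  have /matrixP/(_ i 0) := balanced X; rewrite summxE mxE => h.
  under eq_bigr do rewrite mulrCA.
  rewrite -mulr_sumr (_ : \sum_(_ | _) _ = 0) ?mulr0 // -[RHS]h.
  by apply: eq_bigr => rho _; rewrite mxE.
by apply: ler_sum => rho _; rewrite ler_wpM2l ?(mP _).2 // ltW ?weight_gt0.
Qed.

(* e_j for 1 <= j <= n; the coordinates are numbered from 0. *)
Definition std_vec (n j : nat) : 'cV[int]_n := \col_(k < n) (k.+1 == j)%:R.

Definition line_dir (n r i : nat) : 'cV[int]_n :=
  if i == 0%N then - \sum_(1 <= j < r) std_vec n j else std_vec n i.

Section TropicalLine.
Variables (R : realType) (n r : nat).
Hypothesis hr : (2 <= r <= n.+1)%N.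

Let line_rays : {fset (set 'cV[R]_n)} :=
  [fset ray R (line_dir n r (i : 'I_r)) | i in 'I_r]%fset.

Lemma primitive_coord1 (d : 'cV[int]_n) k : `|(d k 0)%R|%N = 1%N -> primitive d.
Proof.
by move=> h; rewrite /primitive -dvdn1 -h; exact: (@biggcdn_inf _ k).
Qed.

Lemma line_dir0 (k : 'I_n) : line_dir n r 0 k 0 = - (k.+1 < r)%:R.
Proof.
rewrite mxE summxE; congr (- _).
under eq_bigr do rewrite mxE.
case: ltnP => h.
  rewrite (bigD1_seq k.+1) ?iota_uniq ?mem_index_iota //= eqxx.
  by rewrite big1 ?addr0 // => j; rewrite eq_sym => /negbTE ->.
rewrite big_nat big1 // => j /andP[_ jr].
by rewrite gtn_eqF // (leq_trans jr).
Qed.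

Lemma primitive_line_dir (i : 'I_r) : primitive (line_dir n r i).
Proof.
have /andP[r2 rn] := hr.
have [i0|i0] := eqVneq (i : nat) 0%N.
  have n0 : (0 < n)%N by rewrite -ltnS (leq_trans r2).
  by apply: (@primitive_coord1 _ (Ordinal n0)); rewrite i0 line_dir0 r2.
have [j ij] : exists j, i = j.+1 :> nat by exists i.-1; rewrite prednK ?lt0n.
have jn : (j < n)%N by rewrite -ltnS -ij (leq_trans (ltn_ord i)).
apply: (@primitive_coord1 _ (Ordinal jn)).
by rewrite /line_dir ij mxE eqxx.
Qed.

Lemma line_dir_inj : injective (fun i : 'I_r => line_dir n r i).
Proof.
have /andP[r2 rn] := hr.
have key (i j : 'I_r) : (0 < i)%N -> line_dir n r i = line_dir n r j -> i = j.
  move=> i0 /matrixP h; have [m im] : exists m, i = m.+1 :> nat.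
    by exists i.-1; rewrite prednK.
  have mn : (m < n)%N by rewrite -ltnS -im (leq_trans (ltn_ord i)).
  move: (h (Ordinal mn) 0); have [j0|j0] := eqVneq (j : nat) 0%N.
    by rewrite j0 line_dir0 /line_dir im mxE eqxx /=; case: (_ < _)%N.
  rewrite /line_dir (negbTE j0) im !mxE eqxx /=.
  by case: eqP => // mj _; apply: val_inj; rewrite /= im mj.
move=> i j /= h; have [i0|i0] := posnP i; last exact: key.
have [j0|j0] := posnP j; last exact/esym/key.
by apply: val_inj; rewrite /= i0 j0.
Qed.

Let line_ray_inj : injective (fun i : 'I_r => ray R (line_dir n r i)).
Proof.
move=> i j /= /ray_inj h; apply: line_dir_inj; apply: h;
  exact: primitive_line_dir.
Qed.

Lemma line_rays_neq0 : (0 < #|` line_rays|)%N.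
Proof.
rewrite card_imfset //= -cardE card_ord.
by case/andP: hr => /ltnW.
Qed.

Lemma line_rays_rational rho : rho \in line_rays -> rational_ray rho.
Proof.
move=> /imfsetP[i _ ->]; exists (line_dir n r i) => //.
exact/primitive_neq0/primitive_line_dir.
Qed.

Lemma line_balanced :
  \sum_(rho : line_rays) (1 : int) *: prim_dir (val rho) = 0.
Proof.
under eq_bigr do rewrite scale1r.
rewrite -(big_seq_fsetE _ _ predT (@prim_dir R n)) /= big_imfset /=; last first.
  by move=> i j _ _; apply: line_ray_inj.
under eq_bigr do rewrite prim_dir_ray ?primitive_line_dir //.
rewrite big_enum /= -(big_mkord predT (line_dir n r)).
have /andP[r2 _] := hr.
rewrite big_ltn ?(ltnW r2) //= {1}/line_dir eqxx addrC.
apply/eqP; rewrite subr_eq0; apply/eqP.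
by rewrite !big_nat; apply: eq_bigr => -[].
Qed.

(* The fan L_{n,r}. *)
Definition tropical_line : tropical_fan R n :=
  @TropicalFan R n line_rays (fun=> 1) line_rays_neq0 line_rays_rational
    (fun=> ltr01) line_balanced.

End TropicalLine.

(* The existential quantifier over a proof of 2 <= r <= n + 1 expresses that
   L_{n,r} is defined; GL(n, Z) is the set of invertible integer matrices. *)
Definition smooth_at_0 (R : realType) (n : nat) (X : tropical_fan R n) : Prop :=
  (exists (hr : (2 <= #|` rays X| <= n.+1)%N) (T : 'M[int]_n),
     T \in unitmx /\
     set_bij (fan_support (tropical_line R hr)) (fan_support X)
             (fun v : 'cV[R]_n => map_mx intr T *m v)) /\
  (forall rho : rays X, weight rho = 1).

(* Main.v *)
(* Both conditions amount to: all weights are 1, and every integer function of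
   sum 0 on the rays is realized by a monomial u, i.e. equals
   rho |-> u . d_rho.
   If phi_X is surjective, the constant function 1 forces the weights to be 1;
   any monomial u of a polynomial representing F satisfies u . d_rho <= F rho,
   and when F has sum 0 balancing turns these inequalities into equalities.
   Realizing the functions e_j - e_0 gives an integral left inverse of the
   matrix D with columns d_1, ..., d_{r-1}; by the Smith normal form, D is then
   the first r - 1 columns of a unimodular matrix T, and balancing gives
   T e_0 = d_0. *)
Require Import Defs.
From mathcomp Require Import all_boot all_order all_algebra finmap.
From mathcomp Require Import all_classical all_reals.

Set Implicit Arguments.
Unset Strict Implicit.
Unset Printing Implicit Defensive.

Import Order.TTheory GRing.Theory Num.Theory.

Local Open Scope classical_set_scope.
Local Open Scope ring_scope.

(** The common sum recovers the member at index 0 from the others. Below both sums are 0, and this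
    settles the ray of $e_0$ once the other rays are done. *)
Lemma eq_from_sum (V : zmodType) m (a b : 'I_m.+1 -> V) :
  \sum_i a i = \sum_i b i -> (forall j, a (lift ord0 j) = b (lift ord0 j)) ->
  a =1 b.
Proof.
rewrite !big_ord_recl => sab ab i; have [j ->|->] := unliftP ord0 i => //.
by move: sab; under eq_bigr do rewrite ab; move/addIr.
Qed.

(** * Integer vectors and unimodular matrices *)

Section IntegerVectors.
Variable n : nat.
Implicit Types d u : 'cV[int]_n.

Lemma mulmx_tr_sum u d : (u^T *m d) 0 0 = \sum_(i < n) u i 0 * d i 0.
Proof. by rewrite mxE; apply: eq_bigr => i _; rewrite mxE. Qed.

Lemma dotp_intvE (R : realType) u d :
  dotp u (intv R d) = ((u^T *m d) 0 0)%:~R.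
Proof. by rewrite dotp_intv mulmx_tr_sum. Qed.

Lemma intv_mulmx (R : realType) (T : 'M[int]_n) d :
  intv R (T *m d) = map_mx intr T *m intv R d.
Proof. exact: map_mxM. Qed.

(** The coordinates of [d] are integer combinations of those of [T *m d], with coefficients in
    [invmx T], so a common divisor of the latter divides the former. *)
Lemma primitive_mulmx (T : 'M[int]_n) d :
  T \in unitmx -> primitive d -> primitive (T *m d).
Proof.
move=> Tu /eqP pd; rewrite /primitive -dvdn1.
suff : (vgcd (T *m d) %| vgcd d)%N by rewrite pd.
apply/dvdn_biggcdP => i _.
have -> : d i 0 = (invmx T *m (T *m d)) i 0 by rewrite mulKmx.
rewrite mxE.
suff : (vgcd (T *m d) %| \sum_j invmx T i j * (T *m d) j 0)%Z by [].
apply: rpred_sum => j _; apply: dvdz_mull.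
exact: (@biggcdn_inf _ j).
Qed.

Lemma mulmx_std_vec p (A : 'M[int]_(p, n)) (k : 'I_n) :
  A *m std_vec n k.+1 = col k A.
Proof.
apply/matrixP => i j; rewrite !mxE (bigD1 k) //= mxE eqxx mulr1 big1 ?addr0 //.
by move=> l lk; rewrite mxE eqSS val_eqE (negbTE lk) mulr0.
Qed.

Lemma sum_line_dir m : \sum_(i < m.+1) line_dir n m.+1 i = 0.
Proof.
rewrite big_ord_recl {1}/line_dir /= big_add1 big_mkord addrC.
by apply/eqP; rewrite subr_eq0; apply/eqP/eq_bigr.
Qed.

End IntegerVectors.

(** Let $D = LSR$ be the Smith normal form and $S'$ the upper square block of $S$. The left inverse
    makes $S'R$ unimodular, and [T] is $L$ times the block diagonal matrix of $S'R$ and 1.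
    Multiplying by [pid_mx m] keeps the first [m] columns. *)
Lemma unimodular_completion n m (D : 'M[int]_(n, m)) (U : 'M[int]_(m, n)) :
  U *m D = 1%:M ->
  (m <= n)%N /\ exists2 T : 'M[int]_n, T \in unitmx & T *m pid_mx m = D.
Proof.
have [L Lu [R Ru [s _ DE]]] := int_Smith_normal_form D.
set S := \matrix_(i, j) _ in DE.
move=> UD; have mn : (m <= n)%N.
  rewrite leqNgt; apply/negP => nm.
  (* If [n < m], the column of index [n] of [S] vanishes, which contradicts the diagonal entry 1 of
     this product. *)
  have : R *m (U *m L *m S) = 1%:M.
    by apply: mulmx1C; rewrite -UD DE !mulmxA.
  rewrite !mulmxA => /matrixP/(_ (Ordinal nm) (Ordinal nm)).
  rewrite !mxE eqxx big1 // => i _.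
  by rewrite [S _ _]mxE /= ltn_eqF ?mulr0n ?mulr0.
(* Writing [n] as [m + k] gives the matrices block shapes. *)
split=> //; move: D U L Lu @S DE UD; rewrite -(subnKC mn).
move: (n - m)%N => k D U L Lu S DE UD.
have SE : S = col_mx (usubmx S) 0.
  rewrite -[LHS]vsubmxK; congr col_mx; apply/matrixP => i j; rewrite !mxE /=.
  by rewrite gtn_eqF ?mulr0n // ltn_addr.
have Au : usubmx S *m R \in unitmx.
  have : lsubmx (U *m L) *m (usubmx S *m R) = 1%:M.
    rewrite -UD DE !mulmxA {2}SE -[U *m L in RHS]hsubmxK mul_row_col mulmx0.
    by rewrite addr0.
  by case/mulmx1_unit.
exists (L *m block_mx (usubmx S *m R) 0 0 1%:M).
  by rewrite unitmx_mul Lu unitmxE det_ublock det1 mulr1.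
have -> : pid_mx m = col_mx 1%:M 0 :> 'M[int]_(m + k, m).
  apply/matrixP => i j; rewrite !mxE; case: splitP => l il; rewrite !mxE il.
    by rewrite andbT.
  by rewrite andbF.
rewrite -mulmxA mul_block_col !mulmx1 !mulmx0 !addr0.
by rewrite DE -mulmxA {2}SE mul_col_mx mul0mx.
Qed.

(** * Functions of sum 0 realized by monomials *)

Lemma line_dir_lift n m (j : 'I_m) :
  line_dir n m.+1 (lift ord0 j) = std_vec n j.+1.
Proof. by []. Qed.

(** The index type is general so that it can be ['I_r], for the tropical line, or the set of rays of
    a fan. *)
Definition realizes_sum0 n (I : finType) (d : I -> 'cV[int]_n) :=
  forall G : I -> int, \sum_i G i = 0 ->
  exists u : 'cV[int]_n, forall i, (u^T *m d i) 0 0 = G i.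

(** The exponent has the values of [G] at the indices 1, ..., r-1 as its first coordinates and 0 as
    the remaining ones. *)
Lemma line_dir_realizes n r : (0 < r <= n.+1)%N ->
  realizes_sum0 (fun i : 'I_r => line_dir n r i).
Proof.
case: r => // m /= mn G sG.
pose u := \col_(k < n)
  if insub (k : nat) is Some j then G (lift ord0 (j : 'I_m)) else 0.
exists u; apply: eq_from_sum => [|j].
  by rewrite sG -summxE -mulmx_sumr sum_line_dir mulmx0 mxE.
have jn : (j < n)%N by exact: leq_trans (ltn_ord j) mn.
by rewrite line_dir_lift (mulmx_std_vec _ (Ordinal jn)) !mxE /= valK.
Qed.

(** The exponent $(T^{-1})^T u$ pairs with $T d_i$ as $u$ pairs with $d_i$. *)
Lemma realizes_mulmx n (I : finType) (d : I -> 'cV[int]_n) (T : 'M[int]_n) :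
  T \in unitmx -> realizes_sum0 d -> realizes_sum0 (fun i => T *m d i).
Proof.
move=> Tu dP G /dP[u uP]; exists ((invmx T)^T *m u) => i.
by rewrite trmx_mul trmxK -mulmxA mulKmx.
Qed.

Lemma realizes_bij n (I J : finType) (e : I -> J) (d : I -> 'cV[int]_n)
    (d' : J -> 'cV[int]_n) :
  bijective e -> (forall i, d' (e i) = d i) ->
  realizes_sum0 d -> realizes_sum0 d'.
Proof.
move=> eb dd' dP G sG; have [|u uP] := dP (G \o e).
  by rewrite -[RHS]sG [RHS](reindex e) //; apply: onW_bij.
by case: eb => e' _ eK; exists u => j; rewrite -(eK j) dd' uP.
Qed.

Lemma line_completion n r (d : 'I_r -> 'cV[int]_n) :
  (0 < r)%N -> \sum_i d i = 0 -> realizes_sum0 d ->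
  (r <= n.+1)%N /\
  exists2 T : 'M[int]_n, T \in unitmx & forall i : 'I_r, T *m line_dir n r i = d i.
Proof.
case: r d => // m d _ d0 dP.
have /choice[u uP] (j : 'I_m) : exists u : 'cV[int]_n,
    forall k, (u^T *m d (lift ord0 k)) 0 0 = (j == k)%:R.
  (* The value -1 at index 0 makes the sum 0; index 0 contributes no column to [D], so these
     exponents are the rows of a left inverse. *)
  have [|u uP] := dP (fun i =>
      if unlift ord0 i is Some k then (j == k)%:R else -1).
    rewrite big_ord_recl unlift_none; under eq_bigr do rewrite liftK.
    rewrite (bigD1 j) //= eqxx big1 ?addr0 // => k.
    by rewrite eq_sym => /negbTE->.
  by exists u => k; rewrite uP liftK.
pose D := \matrix_(k, j) d (lift ord0 j) k 0.
pose U := \matrix_(j, k) u j k 0.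
have UD : U *m D = 1%:M.
  apply/matrixP => j k; rewrite [RHS]mxE -uP !mxE.
  by apply: eq_bigr => l _; rewrite !mxE.
have [mn [T Tu TD]] := unimodular_completion UD.
split=> //; exists T => //; apply: eq_from_sum => [|j].
  by rewrite -mulmx_sumr sum_line_dir mulmx0 d0.
have -> : d (lift ord0 j) = col j D.
  by apply/matrixP => k l; rewrite ord1 !mxE.
rewrite -TD line_dir_lift colE -mulmxA -colE; congr (_ *m _).
apply/matrixP => k l; rewrite !mxE eqSS.
by case: eqP => //= ->; rewrite ltn_ord.
Qed.

Lemma bl_eval_attained (R : realType) n (P : boolLaurent n) (q : 'cV[R]_n) l :
  (forall u, P u -> dotp u q <= l) -> (exists2 u, P u & dotp u q = l) ->
  bl_eval P q = l%:E.
Proof.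
have PE u : u \in finsupp P -> P u by rewrite mem_finsupp; case: (P u).
move=> ub [u Pu ul]; apply/eqP; rewrite eq_le /bl_eval big_seq; apply/andP; split.
  apply: bigmax_le => [|v /PE Pv]; first exact: leNye.
  by rewrite Pv add0e lee_fin ub.
have uP : u \in finsupp P by rewrite mem_finsupp Pu.
by apply: (bigmax_sup_seq _ u); rewrite // Pu add0e lee_fin ul.
Qed.

(** The scaling factor is nonzero because [d'] is, so both vectors span the same ray. *)
Lemma primitive_on_ray (R : realType) n (d d' : 'cV[int]_n) :
  primitive d -> primitive d' -> ray R d (intv R d') -> d = d'.
Proof.
move=> pd pd' [t /= t0 td]; apply: (ray_inj (R := R)) => //.
have tn0 : t != 0.
  apply: contraTneq (primitive_neq0 pd') => t0'; rewrite negbK; apply/eqP.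
  move: td; rewrite t0' scale0r => /matrixP h.
  by apply/matrixP => i j; apply: (@intr_inj R); have := h i j; rewrite !mxE.
apply/seteqP; split=> _ [s /= s0 <-].
  by exists (s / t); rewrite /= ?divr_ge0 // -td scalerA divfK.
by exists (s * t); rewrite /= ?mulr_ge0 // -td scalerA.
Qed.

(** * Surjectivity and smoothness of a fan *)

Section Fan.
Variables (R : realType) (n : nat) (X : tropical_fan R n).
Implicit Types rho : rays X.

Let d rho := prim_dir (val rho).

Lemma prim_dir_primitive rho : primitive (d rho).
Proof. by have [] := prim_dirP (rays_rational (valP rho)). Qed.

Lemma ray_prim_dir rho : ray R (d rho) = val rho.
Proof. by have [_ <-] := prim_dirP (rays_rational (valP rho)). Qed.

(** A single ray of positive weight cannot be balanced. *)
Lemma fan_has_two_rays : (2 <= #|` rays X|)%N.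
Proof.
rewrite ltn_neqAle rays_neq0 andbT cardfE eq_sym; apply/negP => /eqP c1.
have [rho0 rhoE] : exists rho0 : rays X, forall rho, rho = rho0.
  have /card1P[x xP] := introT eqP c1; exists x => y.
  by have /esym := xP y; rewrite !inE => /eqP.
have := balanced X; rewrite (bigD1 rho0) //= big1 => [|rho]; last first.
  by rewrite (rhoE rho) eqxx.
have [i di] := neq0_coord (primitive_neq0 (prim_dir_primitive rho0)).
move=> /matrixP/(_ i 0)/eqP; rewrite addr0 !mxE mulf_eq0 (negbTE di) orbF.
by rewrite gt_eqF ?weight_gt0.
Qed.

Lemma weighted_eval_surjP :
  set_surj [set: boolLaurent_fcn R n] (Zpos_ninfty X) (weighted_eval X) <->
  (forall rho, weight rho = 1) /\ realizes_sum0 d.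
Proof.
split=> [surj|[w1 dP] G].
  have ex (F : rays X -> int) : 0 <= \sum_rho F rho ->
      exists (u : 'cV[int]_n) (m : rays X -> int),
      forall rho, weight rho * m rho = F rho /\ (u^T *m d rho) 0 0 <= m rho.
    move=> sF; have /surj[f _ fF] : Zpos_ninfty X (fun rho => (F rho)%:~R%:E).
      by right; exists F.
    have fFrho rho := congr1 (fun H => H rho) fF.
    (* A polynomial with empty support takes the value $-\infty$ on some ray, whereas [F] is
       finite. *)
    have [f0|[u uf]] := fset_0Vmem (finsupp (repr f)).
      have : (0 < #|{: rays X}|)%N by rewrite -cardfE rays_neq0.
      move=> /card_gt0P[rho _]; have := fFrho rho.
      rewrite /weighted_eval /fcn_eval bl_eval0 // gt0_muleNy //.
      by rewrite lte_fin ltr0z weight_gt0.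
    have [m mP] := bl_eval_intv R uf; exists u, (fun rho => m (d rho)) => rho.
    split; last by rewrite mulmx_tr_sum (mP _).2.
    have := fFrho rho; rewrite /weighted_eval /fcn_eval (mP _).1 -EFinM.
    by move=> -[]; rewrite -intrM => /intr_inj.
  have w1 rho : weight rho = 1.
    have [|u [m mP]] := ex (fun=> 1); first by apply: sumr_ge0.
    have := weight_gt0 rho; have := (mP rho).1; case: (weight rho) => // w.
    move=> /(congr1 absz); rewrite abszM /= => /eqP.
    by rewrite muln_eq1 => /andP[/eqP->].
  split=> // F sF; have [|u [m mP]] := ex F; first by rewrite sF.
  exists u => rho.
  have le rho' : (u^T *m d rho') 0 0 <= F rho'.
    by have [<-] := mP rho'; rewrite w1 mul1r.
  have su : \sum_rho (u^T *m d rho) 0 0 = 0.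
    rewrite -summxE -mulmx_sumr (_ : \sum_rho d rho = 0) ?mulmx0 ?mxE //.
    by rewrite -[RHS](balanced X); apply: eq_bigr => r _; rewrite w1 scale1r.
  have /eqP : \sum_rho (F rho - (u^T *m d rho) 0 0) = 0.
    by rewrite sumrB sF su subrr.
  rewrite psumr_eq0; last by move=> r _; rewrite subr_ge0.
  by move=> /allP/(_ rho (mem_index_enum _)); rewrite subr_eq0 => /eqP->.
have eval_pi (P : boolLaurent n) :
    weighted_eval X (\pi_(boolLaurent_fcn R n)%qT P) =
    fun rho => bl_eval P (intv R (d rho)).
  by apply/funext => rho; rewrite /weighted_eval w1 mul1e fcn_eval_pi.
case=> [->|[F sF ->]].
  exists (\pi_(boolLaurent_fcn R n)%qT [fsfun]) => //; rewrite eval_pi.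
  by apply/funext => rho; rewrite bl_eval0 // finsupp0.
have [rho0 [rho1 rho01]] : exists rho0 rho1 : rays X, rho0 != rho1.
  have := fan_has_two_rays; rewrite cardfE => /card_gt1P[x [y [_ _ xy]]].
  by exists x, y.
(* Lowering F by its total at a single ray gives a function of sum 0, which is
   realized by a monomial; two such monomials, for two different rays, have
   maximum F. *)
set s := \sum_rho _ in sF.
have ex r0 : exists u : 'cV[int]_n, forall rho,
    (u^T *m d rho) 0 0 = F rho - s *+ (rho == r0).
  apply: dP; rewrite sumrB -/s [X in _ - X](bigD1 r0) //= eqxx.
  by rewrite [X in _ - (_ + X)]big1 ?addr0 ?subrr // => r /negbTE->.
have [u0 u0P] := ex rho0; have [u1 u1P] := ex rho1.
pose P : boolLaurent n := [fsfun u in [fset u0; u1]%fset => true].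
have PE u : P u = (u == u0) || (u == u1).
  by rewrite fsfun_fun !inE; case: ifP.
exists (\pi_(boolLaurent_fcn R n)%qT P) => //; rewrite eval_pi.
apply/funext => rho.
apply: bl_eval_attained => [u|].
  rewrite PE dotp_intvE ler_int => /orP[]/eqP->; rewrite (u0P, u1P).
    by rewrite gerBl mulrn_wge0.
  by rewrite gerBl mulrn_wge0.
(* At [rho0] the bound is attained by [u1], which is lowered only at [rho1]; at every other ray it
   is attained by [u0]. *)
have [->|/negbTE r0] := eqVneq rho rho0.
  by exists u1; rewrite ?PE ?eqxx ?orbT // dotp_intvE u1P (negbTE rho01) subr0.
by exists u0; rewrite ?PE ?eqxx // dotp_intvE u0P r0 subr0.
Qed.

Lemma fan_support_line r (hr : (2 <= r <= n.+1)%N) :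
  fan_support (tropical_line R hr) =
  \bigcup_(i in [set: 'I_r]) ray R (line_dir n r i).
Proof.
apply/seteqP; split=> v.
  by move=> [_ /= /imfsetP[i _ ->] iv]; exists i.
by move=> [i _ iv]; exists (ray R (line_dir n r i)) => //=; apply: in_imfset.
Qed.

Lemma smooth_at_0P :
  smooth_at_0 X <-> (forall rho, weight rho = 1) /\ realizes_sum0 d.
Proof.
split=> [[[hr [T [Tu [Tfun _ _]]]] w1]|[w1 dP]].
  split=> //.
  (* The image of a direction of the line lies on a ray of [X] and is primitive, so it is the
     primitive direction of that ray. *)
  have /choice[e eP] (i : 'I_(#|` rays X|)) : exists rho,
      d rho = T *m line_dir n #|` rays X| i.
    have pl := primitive_line_dir hr i.
    have : fan_support X (map_mx intr T *m intv R (line_dir n #|` rays X| i)).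
      apply: Tfun; rewrite fan_support_line; exists i => //.
      by exists 1; rewrite /= ?ler01 ?scale1r.
    rewrite -intv_mulmx => -[rho /= rhoX].
    rewrite -[X in X _](ray_prim_dir [` rhoX]%fset) => Tl; exists [` rhoX]%fset.
    apply: primitive_on_ray Tl; first exact: prim_dir_primitive.
    exact: primitive_mulmx.
  have einj : injective e.
    move=> i j /(congr1 d); rewrite !eP => /(congr1 (mulmx (invmx T))).
    by rewrite !mulKmx //; apply: line_dir_inj.
  have eb : bijective e by apply: inj_card_bij => //; rewrite card_ord cardfE.
  apply: (realizes_bij eb eP); apply: realizes_mulmx => //.
  by apply: line_dir_realizes; have /andP[/ltnW -> ->] := hr.
(* Any numbering of the rays will do, since the realization property is invariant under
   reindexing. *)
have [e eb] : exists e : 'I_(#|` rays X|) -> rays X, bijective e.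
  exists (enum_val \o cast_ord (cardfE (rays X))).
  apply: inj_card_bij; last by rewrite card_ord cardfE.
  exact: inj_comp enum_val_inj (@cast_ord_inj _ _ _).
have [e' eK e'K] := eb.
have d0 : \sum_i d (e i) = 0.
  rewrite -[RHS](balanced X) [RHS](reindex e) /=; last exact: onW_bij.
  by apply: eq_bigr => i _; rewrite w1 scale1r.
have e'b : bijective e' by exists e.
have [|rn [T Tu TP]] := line_completion (rays_neq0 X) d0.
  by apply: (realizes_bij e'b) dP => rho; rewrite e'K.
have hr : (2 <= #|` rays X| <= n.+1)%N by rewrite fan_has_two_rays.
split=> //; exists hr, T; split=> //; rewrite fan_support_line; split.
- move=> _ [i _ [t t0 <-]]; exists (val (e i)); first exact: valP.
  by rewrite -ray_prim_dir -scalemxAr -intv_mulmx TP; exists t.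
- move=> v v' _ _ /(congr1 (mulmx (map_mx intr (invmx T)))).
  by rewrite !mulmxA -map_mxM mulVmx // map_mx1 !mul1mx.
- move=> w [rho rhoX]; rewrite -[X in X _](ray_prim_dir [` rhoX]%fset).
  move=> [t t0 <-]; set r := FSetSub _; pose i := e' r.
  exists (t *: intv R (line_dir n #|` rays X| i)); first by exists i => //; exists t.
  by rewrite -scalemxAr -intv_mulmx TP e'K.
Qed.

End Fan.

Theorem theorem1p3 (R : realType) (n : nat) (X : tropical_fan R n) :
  smooth_at_0 X <->
  set_surj [set: boolLaurent_fcn R n] (Zpos_ninfty X) (weighted_eval X).
Proof. by rewrite smooth_at_0P weighted_eval_surjP. Qed.
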